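(* Let $\mathbf A$ be a semilinear Dunn monoid. Then the following are equivalent: (1) $\mathbf A$ is negatively generated; (2) $\mathbf A$ is a generalized Sugihara monoid; (3) $\mathbf A$ satisfies the equation $x=(x\wedge e)\cdot(x^*\wedge e)^*$.
   Context: A (commutative) residuated lattice (RL) is an algebra $\langle A;\cdot,\to,\wedge,\vee,e\rangle$ such that $\langle A;\cdot,e\rangle$ is a commutative monoid, $\langle A;\wedge,\vee\rangle$ is a lattice, and $x\cdot y\leqslant z \iff y\leqslant x\to z$. A Dunn monoid is an RL with distributive lattice reduct satisfying $x\leqslant x\cdot x$. An RL is semilinear if it is isomorphic to a subdirect product of totally ordered RLs, idempotent if $a\cdot a=a$ for all $a$, and negatively generated if it is generated (as an RL) by the set $\{a\in A: a\leqslant e\}$. Write $x^*:=x\to e$. A generalized Sugihara monoid is a semilinear idempotent RL satisfying $(x\vee e)^{**}=x\vee e$. *)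

(* Defs.v *)
From mathcomp Require Import all_boot.
From Stdlib Require Import FunctionalExtensionality.

Set Implicit Arguments.
Unset Strict Implicit.
Unset Printing Implicit Defensive.

Reserved Notation "A `&` B" (at level 48, left associativity).
Reserved Notation "A `|` B" (at level 52, left associativity).
Reserved Notation "A `->` B" (at level 55, right associativity).

(* Commutative residuated lattices.  The lattice is given equationally; its  *)
(* order is x <= y :<-> x `&` y = x, which is the order used in residuation. *)
Record RL : Type := MkRL {
  rl_sort :> Type;
  rl_mul : rl_sort -> rl_sort -> rl_sort;
  rl_res : rl_sort -> rl_sort -> rl_sort;
  rl_meet : rl_sort -> rl_sort -> rl_sort;
  rl_join : rl_sort -> rl_sort -> rl_sort;
  rl_e : rl_sort;
  rl_mulA : associative rl_mul;
  rl_mulC : commutative rl_mul;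
  rl_mul1 : left_id rl_e rl_mul;
  rl_meetA : associative rl_meet;
  rl_meetC : commutative rl_meet;
  rl_joinA : associative rl_join;
  rl_joinC : commutative rl_join;
  rl_joinK : forall x y, rl_meet x (rl_join x y) = x;
  rl_meetK : forall x y, rl_join x (rl_meet x y) = x;
  rl_resP : forall x y z,
    rl_meet (rl_mul x y) z = rl_mul x y <-> rl_meet y (rl_res x z) = y
}.

Definition rl_le (A : RL) (x y : A) : Prop := rl_meet x y = x.

Declare Scope rl_scope.
Delimit Scope rl_scope with RL.
Bind Scope rl_scope with rl_sort.

Notation "1" := (@rl_e _) : rl_scope.
Notation "x * y" := (rl_mul x y) : rl_scope.
Notation "x `->` y" := (rl_res x y) : rl_scope.
Notation "x `&` y" := (rl_meet x y) : rl_scope.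
Notation "x `|` y" := (rl_join x y) : rl_scope.
Notation "x <= y" := (rl_le x y) : rl_scope.

Local Open Scope rl_scope.

Definition rl_star (A : RL) (x : A) : A := x `->` 1.
Notation "x ^*" := (rl_star x) : rl_scope.

Section Properties.

Variable A : RL.

Definition totally_ordered : Prop := forall x y : A, x <= y \/ y <= x.

Definition distributive_lattice : Prop :=
  left_distributive (@rl_meet A) (@rl_join A).

Definition dunn_monoid : Prop :=
  distributive_lattice /\ forall x : A, x <= x * x.

Definition idempotent_rl : Prop := forall a : A, a * a = a.

Definition subuniverse (S : A -> Prop) : Prop :=
  [/\ S 1,
      forall x y, S x -> S y -> S (x * y),
      forall x y, S x -> S y -> S (x `->` y),
      forall x y, S x -> S y -> S (x `&` y)
    & forall x y, S x -> S y -> S (x `|` y)].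

Definition generated_by (X : A -> Prop) : Prop :=
  forall S : A -> Prop,
    subuniverse S -> (forall x, X x -> S x) -> forall a, S a.

Definition negatively_generated : Prop := generated_by (fun a => a <= 1).

End Properties.

Definition rl_hom (A B : RL) (h : A -> B) : Prop :=
  [/\ h 1 = 1,
      {morph h : x y / x * y >-> x * y},
      {morph h : x y / x `->` y >-> x `->` y},
      {morph h : x y / x `&` y >-> x `&` y}
    & {morph h : x y / x `|` y >-> x `|` y}].

Section DirectProduct.

Variables (I : Type) (B : I -> RL).

Local Notation T := (forall i, B i).

Local Ltac pointwise lem :=
  repeat intro; apply: functional_extensionality_dep => ?; apply: lem.

Definition dp_mul (x y : T) : T := fun i => x i * y i.
Definition dp_res (x y : T) : T := fun i => x i `->` y i.
Definition dp_meet (x y : T) : T := fun i => x i `&` y i.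
Definition dp_join (x y : T) : T := fun i => x i `|` y i.
Definition dp_e : T := fun i => 1.

Lemma dp_mulA : associative dp_mul. Proof. pointwise rl_mulA. Qed.
Lemma dp_mulC : commutative dp_mul. Proof. pointwise rl_mulC. Qed.
Lemma dp_mul1 : left_id dp_e dp_mul. Proof. pointwise rl_mul1. Qed.
Lemma dp_meetA : associative dp_meet. Proof. pointwise rl_meetA. Qed.
Lemma dp_meetC : commutative dp_meet. Proof. pointwise rl_meetC. Qed.
Lemma dp_joinA : associative dp_join. Proof. pointwise rl_joinA. Qed.
Lemma dp_joinC : commutative dp_join. Proof. pointwise rl_joinC. Qed.
Lemma dp_joinK x y : dp_meet x (dp_join x y) = x. Proof. pointwise rl_joinK. Qed.
Lemma dp_meetK x y : dp_join x (dp_meet x y) = x. Proof. pointwise rl_meetK. Qed.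
Lemma dp_resP x y z : dp_meet (dp_mul x y) z = dp_mul x y <-> dp_meet y (dp_res x z) = y.
Proof.
split=> H; apply: functional_extensionality_dep => i.
  by apply/rl_resP; apply: (f_equal (fun f : T => f i) H).
by apply/rl_resP; apply: (f_equal (fun f : T => f i) H).
Qed.

Definition direct_product : RL :=
  MkRL dp_mulA dp_mulC dp_mul1 dp_meetA dp_meetC dp_joinA dp_joinC dp_joinK dp_meetK dp_resP.

End DirectProduct.

Definition subdirect_product (I : Type) (B : I -> RL)
    (S : direct_product B -> Prop) : Prop :=
  subuniverse S /\ forall i (b : B i), exists2 f, S f & f i = b.

(* A is isomorphic to the subalgebra of P with universe S: a homomorphism    *)
(* that maps A bijectively onto S.                                           *)
Definition isomorphic_to_sub (A P : RL) (S : P -> Prop) : Prop :=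
  exists h : A -> P,
    [/\ rl_hom h, injective h & forall p, S p <-> exists a, h a = p].

Definition semilinear (A : RL) : Prop :=
  exists (I : Type) (B : I -> RL) (S : direct_product B -> Prop),
    [/\ forall i, totally_ordered (B i),
        subdirect_product S
      & isomorphic_to_sub A S].

Definition generalized_sugihara_monoid (A : RL) : Prop :=
  [/\ semilinear A,
      idempotent_rl A
    & forall x : A, (x `|` 1)^*^* = x `|` 1].

(* Main.v *)
Require Import Defs.
From mathcomp Require Import all_boot.
From Stdlib Require Import FunctionalExtensionality.

(** (3) visibly writes every element in terms of negative ones.  The other
    implications are checked in the totally ordered factors of [A], which inherit
    the hypotheses as homomorphic images.  For (2) => (3), compare [x] with [e].
    For (1) => (2), in a square-increasing chain the elements of the form [a] or
    [a^*] with [a <= e] are all idempotent and form a subuniverse; if the chain is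
    negatively generated they exhaust it, and an element above [e] is then some
    [a^*], which is fixed by [**]. *)

Set Implicit Arguments.
Unset Strict Implicit.
Unset Printing Implicit Defensive.

Local Open Scope rl_scope.

(** * Order, residuation and the operation [^*] *)

Section ResiduatedLattice.

Variable A : RL.
Implicit Types x y z a : A.

Lemma rl_meetxx x : x `&` x = x.
Proof. by rewrite -{2}[x](rl_meetK x x) rl_joinK. Qed.

Lemma rl_lexx x : x <= x.
Proof. exact: rl_meetxx. Qed.

Lemma rl_le_trans y x z : x <= y -> y <= z -> x <= z.
Proof. by rewrite /rl_le => Hxy Hyz; rewrite -Hxy -rl_meetA Hyz. Qed.

Lemma rl_le_anti x y : x <= y -> y <= x -> x = y.
Proof. by rewrite /rl_le => Hxy Hyx; rewrite -Hxy rl_meetC Hyx. Qed.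

Lemma rl_join_r x y : x <= y -> x `|` y = y.
Proof. by move=> H; rewrite rl_joinC -{1}H rl_meetC rl_meetK. Qed.

Lemma rl_join_l x y : y <= x -> x `|` y = x.
Proof. by rewrite rl_joinC; exact: rl_join_r. Qed.

Lemma rl_meet_r x y : y <= x -> x `&` y = y.
Proof. by rewrite rl_meetC. Qed.

Lemma rl_leIr x y : x `&` y <= y.
Proof. by rewrite /rl_le -rl_meetA rl_meetxx. Qed.

Lemma rl_leUr x y : y <= x `|` y.
Proof. by rewrite /rl_le rl_joinC rl_joinK. Qed.

Lemma rl_mulx1 x : x * 1 = x.
Proof. by rewrite rl_mulC rl_mul1. Qed.

Lemma rl_le_res x y z : y <= x `->` z <-> x * y <= z.
Proof. by split=> /rl_resP. Qed.

Lemma rl_mul_res x y : x * (x `->` y) <= y.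
Proof. by apply/rl_le_res; exact: rl_lexx. Qed.

Lemma rl_le_mul2l x y z : y <= z -> x * y <= x * z.
Proof.
move=> H; apply/rl_le_res; apply: (rl_le_trans H).
by apply/rl_le_res; exact: rl_lexx.
Qed.

Lemma rl_le_mul2r x y z : y <= z -> y * x <= z * x.
Proof. by move=> H; rewrite ![_ * x]rl_mulC; exact: rl_le_mul2l. Qed.

Lemma rl_mul_le1l x y : x <= 1 -> x * y <= y.
Proof. by move=> H; rewrite -{2}[y]rl_mul1; exact: rl_le_mul2r. Qed.

Lemma rl_mul_le1r x y : y <= 1 -> x * y <= x.
Proof. by rewrite rl_mulC; exact: rl_mul_le1l. Qed.

Lemma rl_mul_ge1r x y : 1 <= y -> x <= x * y.
Proof. by move=> H; rewrite -{1}[x]rl_mulx1; exact: rl_le_mul2l. Qed.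

Lemma rl_res_curry x y z : x `->` (y `->` z) = (x * y) `->` z.
Proof.
apply: rl_le_anti.
  apply/rl_le_res; rewrite [x * y]rl_mulC -rl_mulA.
  by apply/rl_le_res; exact: rl_mul_res.
apply/rl_le_res; apply/rl_le_res; rewrite rl_mulA [y * x]rl_mulC.
exact: rl_mul_res.
Qed.

Lemma rl_star_anti x y : x <= y -> y^* <= x^*.
Proof.
move=> H; apply/rl_le_res; apply: rl_le_trans (rl_mul_res y 1).
exact: rl_le_mul2r.
Qed.

Lemma rl_le_starstar x : x <= x^*^*.
Proof. by apply/rl_le_res; rewrite rl_mulC; exact: rl_mul_res. Qed.

(** The operation [^*] is antitone and forms a Galois connection with itself: one inequality is
    [x <= x^*^*] with [^*] applied, the other is the same law at [x^*]. *)
Lemma rl_star3 x : x^*^*^* = x^*.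
Proof.
by apply: rl_le_anti; [apply: rl_star_anti|]; exact: rl_le_starstar.
Qed.

Lemma rl_star1 : 1^* = 1 :> A.
Proof.
apply: rl_le_anti; first by rewrite -{1}[1^*]rl_mul1; exact: rl_mul_res.
by apply/rl_le_res; rewrite rl_mul1; exact: rl_lexx.
Qed.

Lemma rl_star_ge1 x : x <= 1 -> 1 <= x^*.
Proof. by rewrite -{2}rl_star1; exact: rl_star_anti. Qed.

Lemma rl_star_le1 x : 1 <= x -> x^* <= 1.
Proof. by rewrite -{2}rl_star1; exact: rl_star_anti. Qed.

(** The right-hand side is built by product and residual from [1] and the negative elements [x]&[1]
    and [x^*]&[1]. *)
Lemma neg_star_generated :
  (forall x, x = (x `&` 1) * (x^* `&` 1)^*) -> negatively_generated A.
Proof.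
move=> H3 S [S1 Sm Sr _ _] Sneg x; rewrite (H3 x).
apply: Sm; first by apply: Sneg; exact: rl_leIr.
by apply: Sr => //; apply: Sneg; exact: rl_leIr.
Qed.

(** If [x <= 1], then [1 <= x^*] and the second factor collapses to [1]; if [1 <= x], the first
    factor is [1] and the second is [x^*^*]. *)
Lemma chain_neg_star_decomposition :
  totally_ordered A -> (forall x, (x `|` 1)^*^* = x `|` 1) ->
  forall x, x = (x `&` 1) * (x^* `&` 1)^*.
Proof.
move=> tot H x; case: (tot x 1) => Hx.
  by rewrite Hx (rl_meet_r (rl_star_ge1 Hx)) rl_star1 rl_mulx1.
rewrite (rl_meet_r Hx) rl_mul1 (rl_star_le1 Hx).
by have := H x; rewrite (rl_join_l Hx).
Qed.

End ResiduatedLattice.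

(** * Totally ordered, square-increasing residuated lattices *)

Section DunnChain.

Variable C : RL.
Hypothesis tot : totally_ordered C.
Hypothesis sqr_incr : forall x : C, x <= x * x.
Implicit Types x y a b : C.

Definition neg_or_star x := x <= 1 \/ exists2 a, a <= 1 & x = a^*.

Lemma neg_idem a : a <= 1 -> a * a = a.
Proof. by move=> Ha; apply: rl_le_anti; [exact: rl_mul_le1r|]. Qed.

Lemma neg_mul_min a b : a <= 1 -> a <= b -> b <= 1 -> a * b = a.
Proof.
move=> Ha Hab Hb; apply: rl_le_anti; first exact: rl_mul_le1r.
by rewrite -{1}(neg_idem Ha); exact: rl_le_mul2l.
Qed.

Lemma star_mul_le a b : a <= 1 -> a <= b -> b <= 1 -> a^* * b^* = a^*.
Proof.
move=> Ha Hab Hb; apply: rl_le_anti; last exact: rl_mul_ge1r (rl_star_ge1 Hb).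
apply/rl_le_res; rewrite -{1}(neg_mul_min Ha Hab Hb).
have -> : a * b * (a^* * b^*) = (a * a^*) * (b * b^*).
  by rewrite -!rl_mulA [b * _]rl_mulC -!rl_mulA [b^* * b]rl_mulC.
apply: rl_le_trans (rl_mul_res b 1); apply: rl_mul_le1l; exact: rl_mul_res.
Qed.

Lemma star_idem a : a <= 1 -> a^* * a^* = a^*.
Proof. by move=> Ha; apply: star_mul_le => //; exact: rl_lexx. Qed.

(** If the product is not negative, it equals [b^*]: multiplying [1 <= a * b^*] by the idempotent
    [b^*] gives [b^* <= a * b^*]. *)
Lemma neg_or_star_mul_star a b :
  a <= 1 -> b <= 1 -> neg_or_star (a * b^*).
Proof.
move=> Ha Hb; case: (tot (a * b^*) 1) => [|Hge]; first by left.
right; exists b => //; apply: rl_le_anti; first exact: rl_mul_le1l.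
by rewrite -{2}(star_idem Hb) rl_mulA -{1}[b^*]rl_mul1; exact: rl_le_mul2r.
Qed.

Lemma neg_or_star_mul x y :
  neg_or_star x -> neg_or_star y -> neg_or_star (x * y).
Proof.
case=> [Hx|[a Ha ->]] [Hy|[b Hb ->]].
- by left; apply: rl_le_trans Hy; exact: rl_mul_le1l.
- exact: neg_or_star_mul_star.
- by rewrite rl_mulC; exact: neg_or_star_mul_star.
- right; case: (tot a b) => Hab; first by exists a; rewrite ?star_mul_le.
  by exists b; rewrite // rl_mulC star_mul_le.
Qed.

Lemma neg_or_star_star x : neg_or_star x -> neg_or_star x^*.
Proof.
case=> [Hx|[a Ha ->]]; first by right; exists x.
by left; apply: rl_star_le1; exact: rl_star_ge1.
Qed.

Lemma neg_or_star_res x y :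
  neg_or_star x -> neg_or_star y -> neg_or_star (x `->` y).
Proof.
move=> Sx [Hy|[b Hb ->]]; last first.
  (* Currying gives [x]->[b^* = (x * b)^*]. *)
  rewrite /rl_star rl_res_curry; apply: neg_or_star_star.
  by apply: neg_or_star_mul => //; left.
case: (tot (x `->` y) 1) => [|Hge]; first by left.
case: Sx => [Hx|[a Ha Ea]].
  right; exists x => //; apply: rl_le_anti; apply/rl_le_res.
    by apply: rl_le_trans Hy; exact: rl_mul_res.
  have Hxy : x <= y by rewrite -[x]rl_mulx1; apply/rl_le_res.
  apply: rl_le_trans Hxy; rewrite -{1}(neg_idem Hx) -rl_mulA.
  by apply: rl_mul_le1r; exact: rl_mul_res.
(* Now [1 <= x], so the residual lies below [x] times itself, hence below [y]. *)
left; apply: rl_le_trans Hy; apply: rl_le_trans (rl_mul_res x y).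
by rewrite rl_mulC; apply: rl_mul_ge1r; rewrite Ea; exact: rl_star_ge1.
Qed.

Lemma subuniverse_neg_or_star : subuniverse neg_or_star.
Proof.
split=> [|x y|x y|x y Sx Sy|x y Sx Sy].
- by left; exact: rl_lexx.
- exact: neg_or_star_mul.
- exact: neg_or_star_res.
- by case: (tot x y) => H; [rewrite H | rewrite rl_meet_r].
- by case: (tot x y) => H; [rewrite rl_join_r | rewrite rl_join_l].
Qed.

Hypothesis neg_gen : negatively_generated C.

Lemma neg_or_star_all x : neg_or_star x.
Proof. by apply: (neg_gen subuniverse_neg_or_star) => a; left. Qed.

Lemma neg_gen_chain_idem : idempotent_rl C.
Proof.
move=> x; case: (neg_or_star_all x) => [Hx|[a Ha ->]]; first exact: neg_idem.
exact: star_idem.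
Qed.

Lemma neg_gen_chain_starstar x : (x `|` 1)^*^* = x `|` 1.
Proof.
case: (neg_or_star_all (x `|` 1)) => [Hx|[a _ ->]]; last exact: rl_star3.
have -> : x `|` 1 = 1 by apply: rl_le_anti Hx _; exact: rl_leUr.
by rewrite !rl_star1.
Qed.

End DunnChain.

(** * Passing between a semilinear algebra and its totally ordered factors *)

Lemma negatively_generated_image (A B : RL) (h : A -> B) :
  rl_hom h -> (forall b, exists a, h a = b) ->
  negatively_generated A -> negatively_generated B.
Proof.
move=> [h1 hm hr hi hu] hsurj gA S [S1 Sm Sr Si Su] Sneg b.
(* The preimage of [S] under [h] is a subuniverse of [A] containing all negative elements. *)
have [a <-] := hsurj b; apply: (gA (fun a => S (h a))) => [|x Hx].
  split=> [|x y|x y|x y|x y]; first by rewrite h1.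
  - by rewrite hm; exact: Sm.
  - by rewrite hr; exact: Sr.
  - by rewrite hi; exact: Si.
  - by rewrite hu; exact: Su.
by apply: Sneg; rewrite /rl_le -h1 -hi Hx.
Qed.

(** The coordinates of the embedding are surjective, which carries hypotheses on [A] to the chains,
    and jointly injective, which brings equations back. *)
Lemma semilinear_projections (A : RL) : semilinear A ->
  exists (I : Type) (B : I -> RL) (p : forall i, A -> B i),
    [/\ forall i, totally_ordered (B i),
        forall i, rl_hom (p i),
        forall i b, exists a, p i a = b
      & forall x y, (forall i, p i x = p i y) -> x = y].
Proof.
case=> I [B [S [tot [_ Ssurj] [h [[h1 hm hr hi hu] hinj hS]]]]].
exists I, B, (fun i a => h a i); split=> //.
- by move=> i; split=> [|x y|x y|x y|x y]; rewrite ?h1 ?hm ?hr ?hi ?hu.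
- move=> i b; have [f /hS [a Ea] Ef] := Ssurj i b.
  by exists a; rewrite Ea.
- by move=> x y H; apply: hinj; exact: functional_extensionality_dep.
Qed.

Lemma rl_hom_star (A B : RL) (h : A -> B) :
  rl_hom h -> {morph h : x / x^* >-> x^*}.
Proof. by case=> h1 _ hr _ _ x; rewrite /rl_star hr h1. Qed.

Lemma neg_gen_generalized_sugihara (A : RL) :
  dunn_monoid A -> semilinear A -> negatively_generated A ->
  generalized_sugihara_monoid A.
Proof.
move=> [_ sqA] sA gA.
have [I [B [p [tot hom surj inj]]]] := semilinear_projections sA.
have sqB i (b : B i) : b <= b * b.
  have [a <-] := surj i b; have [_ hm _ hi _] := hom i.
  by rewrite /rl_le -hm -hi sqA.
have gB i := negatively_generated_image (hom i) (surj i) gA.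
split=> // x; apply: inj => i; have [h1 hm _ _ hu] := hom i.
  by rewrite hm (neg_gen_chain_idem (tot i) (sqB i) (gB i)).
rewrite !(rl_hom_star (hom i)) hu h1.
exact: neg_gen_chain_starstar (tot i) (sqB i) (gB i) _.
Qed.

Lemma generalized_sugihara_decomposition (A : RL) :
  generalized_sugihara_monoid A ->
  forall x : A, x = (x `&` 1) * (x^* `&` 1)^*.
Proof.
move=> [sA _ ssA] x.
have [I [B [p [tot hom surj inj]]]] := semilinear_projections sA.
apply: inj => i; have [h1 hm _ hi hu] := hom i; have hst := rl_hom_star (hom i).
rewrite hm hi hst hi hst h1.
apply: chain_neg_star_decomposition (tot i) _ _ => b.
(* Each element of the factor is lifted to [A], where the double-star law holds. *)
by have [a <-] := surj i b; rewrite -h1 -hu -!hst ssA.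
Qed.

Theorem theorem6p17 (A : RL) (hD : dunn_monoid A) (hS : semilinear A) :
  (negatively_generated A <-> generalized_sugihara_monoid A) /\
  (generalized_sugihara_monoid A <->
     forall x : A, x = ((x `&` 1) * (x^* `&` 1)^*)%RL).
Proof.
have H12 := neg_gen_generalized_sugihara hD hS.
have H23 := @generalized_sugihara_decomposition A.
have H31 := @neg_star_generated A.
by split; split=> H; auto.
Qed.
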